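(* Let $E$ be a finite-dimensional real inner-product space, let $U\subset E$ be a nonempty finite set with $0\in\operatorname{conv}U$, and let $A\colon E\to E$ be a linear map (not necessarily symmetric) for which there is $\mu>0$ with $\langle Ax,x\rangle\ge\mu\|x\|^2$ for all $x\in E$. Then there is a constant $C=C(E,U,A)\ge 1$, depending only on $E$, $U$ and $A$, such that for every $B\ge 0$ every $B$-approximate $U$-valued trajectory $(z_k)_{k\ge 0}$ for $(E,U,A)$ satisfies $$\sup_{k\ge 0}\|z_k\|\le C\bigl(1+\|z_0\|+B\bigr).$$
   Context: $\|\cdot\|$ is the norm induced by the inner product. A $U$-valued trajectory consists of states $(z_k)_{k\ge0}$ in $E$ and increments $(u_k)_{k\ge0}$ in $U$ with $z_{k+1}=z_k+u_k$ for all integers $k\ge0$. For $B\ge0$ it is called $B$-approximate for $(E,U,A)$ if $\langle Az_k,u_k\rangle\le\min_{u\in U}\langle Az_k,u\rangle+B$ for every integer $k\ge0$. *)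

(* Defs.v *)
From HB Require Import structures.
From mathcomp Require Export all_boot all_order all_algebra finmap.
From mathcomp Require Export classical_sets reals constructive_ereal ereal.

Set Implicit Arguments.
Unset Strict Implicit.
Unset Printing Implicit Defensive.

Import Order.TTheory GRing.Theory Num.Theory.

Local Open Scope fset_scope.
Local Open Scope ring_scope.

Definition dnorm (R : realType) (E : vectType R) (dot : {dot E for idfun})
    (x : E) : R :=
  Num.sqrt (dot x x).

(* The finite set [U] is duplicate-free, so the weights may be indexed by the
   points of [U] themselves; the values of [w] outside [U] are irrelevant. *)
Definition conv (R : realType) (E : vectType R) (U : {fset E}) : set E :=
  fun x => exists w : E -> R,
    [/\ forall u, u \in U -> 0 <= w u,
        \sum_(u <- U) w u = 1
      & \sum_(u <- U) w u *: u = x].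

(* For nonempty [U] the initial value of the iterated minimum is one of the
   values of [f] on [U], so this is the minimum of [f] over [U]; the value for
   [U = fset0] is meaningless. *)
Definition fset_min (R : realType) (E : vectType R) (U : {fset E})
    (f : E -> R) : R :=
  \big[Num.min/f (head 0 U)]_(u <- U) f u.

Definition trajectory (R : realType) (E : vectType R) (U : {fset E})
    (z u : nat -> E) : Prop :=
  forall k : nat, u k \in U /\ z k.+1 = z k + u k.

Definition approximate (R : realType) (E : vectType R)
    (dot : {dot E for idfun}) (U : {fset E}) (A : {linear E -> E}) (B : R)
    (z u : nat -> E) : Prop :=
  forall k : nat,
    dot (A (z k)) (u k) <= fset_min U (fun v => dot (A (z k)) v) + B.

(* Main.v *)
Require Import Defs.
From mathcomp Require Import all_boot all_order all_algebra finmap.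
From mathcomp Require Import classical_sets reals constructive_ereal ereal.
From mathcomp Require Import boolp ring lra.

Import Order.TTheory GRing.Theory Num.Theory.

Set Implicit Arguments.
Unset Strict Implicit.
Unset Printing Implicit Defensive.

Local Open Scope fset_scope.
Local Open Scope classical_set_scope.
Local Open Scope ring_scope.

(** Write [a(x, v)] for [dot (A x) v], and let the potential [V(z)] be the
    maximum of [- a(z, v)] over [v] in [U] together with [v = 0]. As the origin
    lies in the convex hull of [U], an approximate minimizer [u] at [z] satisfies
    [a(z, u) <= - V(z) + B]; from here on only this inequality is used.

    In continuous time the statement is easy: along a motion whose velocity [p]
    is a mixture of minimizers the derivative of [V] is [- a(p, p)], at most
    [- mu |p|^2], and [p] stays away from [0] while [V > 0]. In discrete time the
    increments oscillate between several minimizers, and the skew part of [A]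
    turns this oscillation into an error of the same order as the gain. The
    remedy is to compare mean velocities at many scales. If over a block of time
    the mean velocity of the last of [K] sub-blocks is close to that of the whole
    block, then the oscillation inside the sub-block averages out and [V]
    decreases as in continuous time ([descent_one_scale]). The square of the
    discrepancy, weighted by the length of a sub-block, is at most the energy
    (length times squared mean velocity) gained when the block is cut into
    sub-blocks. Summed over all scales these gains telescope
    ([descent_scales]) and stay below a constant times the length of the window,
    however many scales there are. Hence with enough scales [V] decreases by a
    definite fraction of the length of the window, as soon as mean velocities
    stay away from [0] ([potential_descent]). The smallest scale only has to
    exceed [B], whence the linear dependence on [B].

    Mean velocities do stay away from [0] when all increments lie in an open
    half-space, uniformly in the half-space since [U] has finitely many subsets
    ([halfspace_sum_bound]). Where [V] is large compared with the window, [- A z]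
    defines such a half-space, so [V] is bounded along the trajectory
    ([potential_bounded]).

    The potential need not control [z], because the origin may lie on the
    boundary of the convex hull of [U]. Let [U0] be the set of vectors that occur
    in positive relations among the elements of [U], that is, the elements of [U]
    in the minimal face of the origin, and split [z = Y z + h] with [Y z] in the
    span of [U0] and [A h] orthogonal to that span. For [v] in [U0] the
    potential bounds [a(z, v)] from both sides, hence it bounds [Y z]. The
    component [h] moves only at steps outside [U0]. By Gordan's theorem its
    increments lie in a fixed open half-space, and [h] is again a greedy
    trajectory with an error bounded in terms of [V]. Its potential decreases at a definite rate and is nonnegative,
    so it makes boundedly many steps ([halfspace_steps_bounded]). *)

(** * Finite families and Euclidean norms *)

Lemma seq_bounded_above (R : realType) (T : eqType) (s : seq T) (f : T -> R) :
  exists2 M : R, 1 <= M & forall x, x \in s -> f x <= M.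
Proof.
elim: s => [|y s [M M1 HM]]; first by exists 1.
exists (Num.max M (f y)); first by rewrite le_max M1.
move=> x; rewrite inE => /orP[/eqP->|/HM xM]; first by rewrite le_max lexx orbT.
by rewrite le_max xM.
Qed.

Lemma seq_common_pos (R : realType) (T : eqType) (s : seq T)
    (P : T -> R -> Prop) :
  (forall x c c', P x c -> 0 < c' -> c' <= c -> P x c') ->
  (forall x, x \in s -> exists2 c, 0 < c & P x c) ->
  exists2 c, 0 < c & forall x, x \in s -> P x c.
Proof.
move=> mono; elim: s => [|y s IH] H; first by exists 1.
have [x xs|c c0 Hc] := IH; first by apply: H; rewrite inE xs orbT.
have [|d d0 Hd] := H y; first by rewrite inE eqxx.
have m0 : 0 < Num.min c d by rewrite lt_min c0.
exists (Num.min c d) => // x; rewrite inE => /orP[/eqP->|xs].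
  by apply: mono Hd _ _ => //; rewrite ge_min lexx orbT.
by apply: mono (Hc _ xs) _ _ => //; rewrite ge_min lexx.
Qed.

Section Euclidean.
Variables (R : realType) (E : vectType R) (dot : {dot E for idfun}).
Implicit Types (x y : E) (X : seq E).

Local Notation norm := (dnorm dot).

Lemma dotC x y : dot x y = dot y x.
Proof. by rewrite hermC expr0 mul1r. Qed.

Lemma dot_ge0 x : 0 <= dot x x.
Proof.
have [->|/(@neq0_dnorm_gt0 _ _ _ dot)/ltW //] := eqVneq x 0.
by rewrite linear0r.
Qed.

Lemma norm_ge0 x : 0 <= norm x.
Proof. exact: sqrtr_ge0. Qed.

Lemma norm_sqr x : norm x ^+ 2 = dot x x.
Proof. by rewrite sqr_sqrtr ?dot_ge0. Qed.

Lemma norm0 : norm 0 = 0.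
Proof. by rewrite /dnorm linear0r sqrtr0. Qed.

Lemma normN x : norm (- x) = norm x.
Proof. by rewrite /dnorm linearNl linearNr opprK. Qed.

Lemma cauchy_schwarz x y : dot x y <= norm x * norm y.
Proof.
have [->|y0] := eqVneq y 0; first by rewrite linear0r norm0 mulr0.
have yy : 0 < dot y y by exact: neq0_dnorm_gt0.
have := dot_ge0 (dot y y *: x - dot x y *: y).
rewrite linearBl /= !linearBr /= !linearZl_LR /= !linearZr_LR /= (dotC y x).
move=> H; have {}H : 0 <= dot y y * (dot x x * dot y y - dot x y ^+ 2).
  by move: H; congr (0 <= _); ring.
rewrite pmulr_rge0// subr_ge0 -!norm_sqr -exprMn in H.
apply: le_trans (ler_norm _) _.
by rewrite -(@ler_pXn2r _ 2) ?nnegrE ?mulr_ge0 ?norm_ge0 // real_normK ?num_real.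
Qed.

Lemma cauchy_schwarz_abs x y : `|dot x y| <= norm x * norm y.
Proof.
rewrite ler_norml cauchy_schwarz andbT lerNl -linearNl.
by rewrite -(normN x) cauchy_schwarz.
Qed.

Lemma norm_triangle x y : norm (x + y) <= norm x + norm y.
Proof.
rewrite -(@ler_pXn2r _ 2) ?nnegrE ?addr_ge0 ?norm_ge0 // sqrrD !norm_sqr.
rewrite linearDl /= !linearDr /= (dotC y x).
by have := cauchy_schwarz x y; lra.
Qed.

Lemma norm_increments (z : nat -> E) (b : R) L :
  (forall k, (k < L)%N -> norm (z k.+1 - z k) <= b) ->
  forall i j, (i <= j <= L)%N -> norm (z j - z i) <= b * (j - i)%:R.
Proof.
move=> H i; elim=> [|j IH].
  by rewrite leqn0 => /andP[/eqP-> _]; rewrite subrr norm0 mulr0.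
rewrite leq_eqVlt => /andP[/orP[/eqP->|ij] jL].
  by rewrite subrr norm0 subnn mulr0.
rewrite subSn // -natr1 mulrDr mulr1.
have -> : z j.+1 - z i = (z j - z i) + (z j.+1 - z j).
  by rewrite [RHS]addrC addrA subrK.
apply: le_trans (norm_triangle _ _) _; apply: lerD; last exact: H.
by apply: IH; rewrite -ltnS ij ltnW.
Qed.

(** * Linear functionals and positive definite forms *)

Lemma eq_scalar_span (f g : {scalar E}) X y :
  (forall v, v \in X -> f v = g v) -> y \in <<X>>%VS -> f y = g y.
Proof.
move=> fg /(@coord_span _ _ _ (in_tuple X)) ->.
rewrite !linear_sum; apply: eq_bigr => i _.
by rewrite !linearZ /= fg // mem_nth.
Qed.

Lemma span_weights X y : uniq X -> y \in <<X>>%VS ->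
  exists c : E -> R, y = \sum_(v <- X) c v *: v.
Proof.
elim: X y => [|v X IH] y /=.
  by rewrite span_nil memv0 => _ /eqP->; exists (fun=> 0); rewrite big_nil.
move=> /andP[vX uX]; rewrite span_cons => /memv_addP[_ /vlineP[k ->]].
move=> [y' /(IH _ uX)[c ->] ->].
exists (fun u => if u == v then k else c u).
rewrite big_cons eqxx; congr (_ + _); apply: eq_big_seq => u uX'.
by case: eqP uX' => // ->; rewrite (negPf vX).
Qed.

(** Gram-Schmidt orthogonalization carried out for a form that is positive but
    not symmetric: the image under [T] of [v - yv] is orthogonal to the previous
    vectors, so a multiple of [v - yv] settles the condition at the new one. *)
Lemma lax_milgram_span (T : {linear E -> E}) X :
  (forall x, x != 0 -> 0 < dot (T x) x) ->
  forall f : {scalar E}, exists2 y, y \in <<X>>%VS &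
    forall v, v \in X -> dot (T y) v = f v.
Proof.
move=> Tpos; elim: X => [|v X IH] f; first by exists 0; rewrite ?mem0v.
have [y' y'X Hy'] := IH f.
have [yv yvX Hyv] := IH (dot (T v)).
have ext w (g : {scalar E}) y : (forall x, x \in X -> dot (T w) x = g x) ->
    y \in <<X>>%VS -> dot (T w) y = g y.
  exact: (@eq_scalar_span (dot (T w)) g).
have orth x : x \in X -> dot (T (v - yv)) x = 0.
  by move=> xX; rewrite linearB linearBl /= Hyv // subrr.
have orthyv : dot (T (v - yv)) yv = 0.
  by rewrite linearB linearBl /= (ext yv (dot (T v)) yv) // subrr.
have sub y : y \in <<X>>%VS -> y \in <<v :: X>>%VS.
  by rewrite span_cons => yX; rewrite -[y]add0r memv_add // mem0v.
have vX : v \in <<v :: X>>%VS by apply: memv_span; rewrite inE eqxx.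
have [e|ne] := eqVneq (v - yv) 0.
  exists y'; first exact: sub.
  move=> x; rewrite inE => /orP[/eqP->|/Hy' //].
  by move/eqP: e; rewrite subr_eq0 => /eqP e; rewrite e; apply: ext.
have pos : 0 < dot (T (v - yv)) v.
  by have := Tpos _ ne; rewrite linearBr /= orthyv subr0.
pose t := (f v - dot (T y') v) / dot (T (v - yv)) v.
exists (y' + t *: (v - yv)).
  by apply: memvD; [exact: sub|apply: memvZ; apply: memvB => //; exact: sub].
move=> x; rewrite linearD linearZ linearDl /= linearZl_LR /= inE.
move=> /orP[/eqP->|xX]; last by rewrite orth // mulr0 addr0 Hy'.
by rewrite /t divfK ?gt_eqF // addrC subrK.
Qed.

(** Riesz representation makes every linear functional bounded. *)
Lemma scalar_bounded (f : {scalar E}) :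
  exists2 C, 1 <= C & forall x, `|f x| <= C * norm x.
Proof.
have [|r _ Hr] := @lax_milgram_span idfun (vbasis (fullv : {vspace E})) _ f.
  by move=> x; exact: neq0_dnorm_gt0.
exists (1 + norm r); first by rewrite lerDl norm_ge0.
move=> x; have -> : f x = dot r x.
  rewrite -(@eq_scalar_span (dot r) f (vbasis (fullv : {vspace E})) x) //.
  by rewrite (span_basis (vbasisP _)) memvf.
apply: le_trans (cauchy_schwarz_abs _ _) _.
by rewrite ler_wpM2r ?norm_ge0 // lerDr.
Qed.

(** * Positive combinations *)

(** The alternative is decided by eliminating one vector at a time: once [l] is
    positive on the other vectors and nonpositive on [f i], each of them is
    slid along [f i] into the hyperplane orthogonal to [l]. *)
Lemma gordan (I : eqType) (s : seq I) (f : I -> E) : uniq s ->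
  (exists l, forall i, i \in s -> 0 < dot l (f i)) \/
  (exists w : I -> R, [/\ forall i, i \in s -> 0 <= w i,
     exists2 i, i \in s & 0 < w i & \sum_(i <- s) w i *: f i = 0]).
Proof.
elim: s f => [|i s IH] f /=; first by left; exists 0.
move=> /andP[si us].
have neqi j : j \in s -> (j == i) = false.
  by move=> js; apply: contraNF si => /eqP <-.
have [[l Hl]|[w [w0 [j js wj] sw]]] := IH f us; last first.
  right; exists (fun k => if k == i then 0 else w k); split.
  - by move=> k; rewrite inE; case: eqVneq => //= _ /w0.
  - by exists j; rewrite ?inE ?js ?orbT // neqi.
  - rewrite big_cons eqxx scale0r add0r -[RHS]sw; apply: eq_big_seq => k ks.
    by rewrite neqi.
have [li|li] := ltP 0 (dot l (f i)).
  by left; exists l => k; rewrite inE => /orP[/eqP->|/Hl].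
have [fi0|fi0] := eqVneq (f i) 0.
  right; exists (fun k => if k == i then 1 else 0); split.
  - by move=> k _; case: ifP.
  - by exists i; rewrite ?eqxx ?inE ?eqxx.
  - rewrite big_cons fi0 scaler0 add0r big1_seq // => k /andP[_ ks].
    by rewrite neqi // scale0r.
pose g k := (- dot l (f i)) *: f k + dot l (f k) *: f i.
have [[b Hb]|[w [w0 [j js wj] sw]]] := IH g us; last first.
  right; exists (fun k => if k == i then \sum_(m <- s) w m * dot l (f m)
                          else - dot l (f i) * w k); split.
  - move=> k; rewrite inE; case: eqVneq => /= [_ _|_ ks].
      by rewrite big_seq sumr_ge0 // => m ms; rewrite mulr_ge0 ?w0 ?ltW ?Hl.
    by rewrite mulr_ge0 ?w0 // oppr_ge0.
  - exists i; rewrite ?inE ?eqxx // (big_rem j) //= ltr_pwDl ?mulr_gt0 ?Hl //.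
    rewrite big_seq sumr_ge0 // => m /mem_rem ms.
    by rewrite mulr_ge0 ?w0 ?ltW ?Hl.
  - rewrite big_cons eqxx -[RHS]sw scaler_suml -big_split /=.
    apply: eq_big_seq => k ks; rewrite neqi // /g scalerDr !scalerA addrC.
    by rewrite [_ * w k]mulrC.
left.
(* [a] vanishes on [f i] and is positive on the other vectors; adding [f i] to a
   large multiple of [a] makes it positive on all of them. *)
pose a := (- dot l (f i)) *: b + dot b (f i) *: l.
have ai : dot a (f i) = 0.
  by rewrite /a linearDl /= !linearZl_LR /=; ring.
have ak k : k \in s -> 0 < dot a (f k).
  move=> /Hb; rewrite /g /a linearDl linearDr /= !linearZl_LR !linearZr_LR /=.
  by rewrite [dot b (f i) * _]mulrC.
have [t _ Ht] := @seq_bounded_above R I s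
  (fun k => - dot (f i) (f k) / dot a (f k)).
exists ((t + 1) *: a + f i) => k; rewrite linearDl /= linearZl_LR /= inE.
have [->|_] /= := eqVneq k i => ks.
  by rewrite ai mulr0 add0r; exact: neq0_dnorm_gt0.
by have := Ht _ ks; rewrite ler_pdivrMr ?ak //; have := ak _ ks; lra.
Qed.

(** A subset of [U] on which some linear functional is positive has a convex
    hull at positive distance from the origin, and there are only finitely many
    such subsets; so the bound is uniform in the functional. *)
Lemma halfspace_sum_bound (U : seq E) : exists2 c : R, 0 < c &
  forall x (r : seq E), (forall v, v \in r -> v \in U /\ 0 < dot x v) ->
    c * (size r)%:R <= norm (\sum_(v <- r) v).
Proof.
pose P (S : {fset E}) (c : R) := forall r : seq E, {subset r <= S} ->
  (exists x, forall v, v \in S -> 0 < dot x v) ->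
  c * (size r)%:R <= norm (\sum_(v <- r) v).
have [||c c0 Hc] := @seq_common_pos R _ (fpowerset [fset v in U]) P.
- move=> S c c' H _ cc' r rS ex; apply: le_trans (H r rS ex).
  by rewrite ler_wpM2r.
- move=> S _; have [[x Hx]|nex] := EM (exists x, forall v, v \in S -> 0 < dot x v);
    last by exists 1 => // r _ /nex.
  have [||d d0 Hd] := @seq_common_pos R _ S (fun v c => c <= dot x v).
  + by move=> v c c' H _ cc'; apply: le_trans H.
  + by move=> v /Hx; exists (dot x v).
  have x1 : 0 < norm x + 1 by rewrite ltr_wpDl ?norm_ge0.
  exists (d / (norm x + 1)); first exact: divr_gt0.
  move=> r rS _; rewrite mulrAC ler_pdivrMr // [leRHS]mulrC.
  apply: (@le_trans _ _ (dot x (\sum_(v <- r) v))); last first.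
    apply: le_trans (cauchy_schwarz _ _) _.
    by rewrite ler_wpM2r ?norm_ge0 // lerDl.
  rewrite linear_sumr /=.
  elim: r rS => [|v r IH] rS /=; first by rewrite big_nil mulr0.
  rewrite big_cons -natr1 mulrDr mulr1 addrC lerD ?Hd ?rS ?inE ?eqxx //.
  by apply: IH => w wr; apply: rS; rewrite inE wr orbT.
exists c => // x r Hr.
pose S := [fset v in U | 0 < dot x v].
apply: (Hc S).
- by rewrite fpowersetE; apply/fsubsetP => v; rewrite !inE => /andP[].
- by move=> v /Hr[vU xv]; rewrite !inE vU.
- by exists x => v; rewrite !inE => /andP[].
Qed.

Lemma norm_dev_le_variance (K l : nat) (x : nat -> E) : (l < K)%N ->
  let s := \sum_(b < K) x b in
  norm (x l - K%:R^-1 *: s) ^+ 2 <=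
  \sum_(b < K) norm (x b) ^+ 2 - norm s ^+ 2 / K%:R.
Proof.
move=> lK /=; set s := \sum_(b < K) x b.
have K0 : K%:R != 0 :> R by rewrite pnatr_eq0 -lt0n (leq_ltn_trans _ lK).
have -> : \sum_(b < K) norm (x b) ^+ 2 - norm s ^+ 2 / K%:R =
    \sum_(b < K) norm (x b - K%:R^-1 *: s) ^+ 2.
  have e (b : 'I_K) : norm (x b - K%:R^-1 *: s) ^+ 2 = norm (x b) ^+ 2
      - (2 / K%:R) * dot s (x b) + K%:R^-1 ^+ 2 * dot s s.
    rewrite !norm_sqr linearBl /= !linearBr /= !linearZl_LR /= !linearZr_LR /=.
    by rewrite (dotC (x b) s); ring.
  rewrite (eq_bigr _ (fun b _ => e b)) big_split sumrB /= -mulr_sumr.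
  rewrite -linear_sumr /= -/s sumr_const card_ord -mulr_natl norm_sqr.
  by field.
rewrite (bigD1 (Ordinal lK)) //= lerDl.
by apply: sumr_ge0 => b _; exact: sqr_ge0.
Qed.

(** * The potential and its descent along greedy steps *)

Section Greedy.
Variables (A : {linear E -> E}) (mu : R).
Hypotheses (mu0 : 0 < mu) (muA : forall x, mu * norm x ^+ 2 <= dot (A x) x).

(** The support function of [0 :: U] at [- A z]. *)
Definition potential (U : seq E) (z : E) : R :=
  \big[Num.max/0]_(v <- U) - dot (A z) v.

Definition greedy_step (U : seq E) (B : R) (x y : E) : Prop :=
  y - x \in U /\ dot (A x) (y - x) <= - potential U x + B.

Lemma potential_ge0 U z : 0 <= potential U z.
Proof.
by rewrite /potential; elim/big_rec: _ => // v x _ x0; rewrite le_max x0 orbT.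
Qed.

Lemma potential_ge U z v : v \in U -> - dot (A z) v <= potential U z.
Proof.
rewrite /potential; elim: U => // w U IH.
rewrite inE big_cons le_max => /orP[/eqP->|/IH->]; first by rewrite lexx.
by rewrite orbT.
Qed.

Lemma potential_le U z b : 0 <= b ->
  (forall v, v \in U -> - dot (A z) v <= b) -> potential U z <= b.
Proof.
by move=> b0 H; rewrite /potential big_seq; elim/big_ind: _ => // x y;
  rewrite ge_max => -> ->.
Qed.

Lemma potential_lip U x y b : 0 <= b ->
  (forall v, v \in U -> `|dot (A (x - y)) v| <= b) ->
  potential U x <= potential U y + b.
Proof.
move=> b0 H; apply: potential_le; first by rewrite addr_ge0 ?potential_ge0.
move=> v vU; have := potential_ge y vU; have := ler_normlW (H v vU).
have := H v vU; rewrite ler_norml linearB linearBl /=; lra.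
Qed.

(** The step [y - x] nearly realizes the maximum defining the potential at [x],
    and is a competitor for the maximum at any other point [w]. *)
Lemma potential_greedy U B x y w : greedy_step U B x y ->
  potential U x - potential U w <= - dot (A (x - w)) (y - x) + B.
Proof.
move=> [yxU H]; have := potential_ge w yxU.
rewrite [A (x - w)]linearB linearBl /=; lra.
Qed.

Section Window.
Variables (U : seq E) (M B : R) (z : nat -> E) (L : nat).
Hypotheses (M1 : 1 <= M) (MU : forall u, u \in U -> norm u <= M)
  (MAU : forall u, u \in U -> norm (A u) <= M)
  (Hz : forall k, (k < L)%N -> greedy_step U B (z k) (z k.+1)).

Local Notation V k := (potential U (z k)).

Lemma norm_window i j : (i <= j <= L)%N -> norm (z j - z i) <= M * (j - i)%:R.
Proof. by apply: norm_increments => k /Hz[zU _]; exact: MU. Qed.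

Lemma norm_image_window i j : (i <= j <= L)%N ->
  norm (A (z j - z i)) <= M * (j - i)%:R.
Proof.
rewrite linearB; apply: (@norm_increments (fun k => A (z k))) => k /Hz[zU _].
by rewrite -linearB; exact: MAU.
Qed.

Lemma form_window i j v : v \in U -> (i <= j <= L)%N ->
  `|dot (A (z j - z i)) v| <= M ^+ 2 * (j - i)%:R.
Proof.
move=> vU ij; apply: le_trans (cauchy_schwarz_abs _ _) _.
rewrite expr2 mulrAC; apply: ler_pM; rewrite ?norm_ge0 //.
  exact: norm_image_window.
exact: MU.
Qed.

Lemma potential_window i j : (i <= j <= L)%N -> V j <= V i + M ^+ 2 * (j - i)%:R.
Proof.
move=> ij; apply: potential_lip; first by rewrite mulr_ge0 ?sqr_ge0.
by move=> v vU; exact: form_window.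
Qed.

Lemma potential_window_ge i j : (i <= j <= L)%N -> V i <= V j + M ^+ 2 * (j - i)%:R.
Proof.
move=> ij; apply: potential_lip; first by rewrite mulr_ge0 ?sqr_ge0.
by move=> v vU; rewrite -opprB linearN linearNl normrN; exact: form_window.
Qed.

(** Averaging [potential_greedy] over the steps of the last [n] times replaces
    these steps by their mean, at the cost of the oscillation of [z] over [n]
    times. *)
Lemma potential_last_block t m n : (n <= m)%N -> (t + m <= L)%N ->
  n%:R * (V (t + m) - V t) <=
  - dot (A (z (t + m) - z t)) (z (t + m) - z (t + m - n)%N)
  + n%:R * (2 * M ^+ 2 * n%:R + B).
Proof.
move=> nm tmL; set e := (t + m)%N; pose j0 := (e - n)%N.
have ne : (n <= e)%N by rewrite (leq_trans nm) // leq_addl.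
have tj : (t <= j0)%N by rewrite /j0 /e -addnBA // leq_addr.
have step i : (j0 <= i < e)%N ->
    V e - V t <= - dot (A (z e - z t)) (z i.+1 - z i) + (2 * M ^+ 2 * n%:R + B).
  move=> /andP[ji ie]; have gi := Hz (leq_trans ie tmL).
  have ieL : (i <= e <= L)%N by rewrite (ltnW ie).
  have := potential_greedy (z t) gi; have := potential_window ieL.
  have := form_window gi.1 ieL; rewrite ler_norml => /andP[_].
  rewrite [A (z e - z i)]linearB [A (z i - z t)]linearB [A (z e - z t)]linearB.
  rewrite !linearBl /=.
  have : M ^+ 2 * (e - i)%:R <= M ^+ 2 * n%:R.
    by rewrite ler_wpM2l ?sqr_ge0 // ler_nat leq_subCl.
  lra.
have -> : z e - z (e - n)%N = \sum_(j0 <= i < e) (z i.+1 - z i).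
  by rewrite telescope_sumr // leq_subr.
rewrite linear_sumr /= ![n%:R * _]mulr_natl -sumrN.
rewrite -[X in _ *+ X <= _](subKn ne) -[X in _ <= _ + _ *+ X](subKn ne) -/j0.
by rewrite -!sumr_const_nat -big_split /=; apply: ler_sum_nat.
Qed.


Section Scales.
Variable c : R.
Hypotheses (c0 : 0 < c)
  (cz : forall i j, (i <= j <= L)%N -> c * (j - i)%:R <= norm (z j - z i)).

(** [energy i n] is [n] times the squared mean velocity over a block. *)
Local Notation energy i n := (norm (z (i + n)%N - z i) ^+ 2 / n%:R).
Local Notation gam := (mu * c ^+ 2 / 2).
Local Notation wgt K := (M ^+ 2 / (mu * c ^+ 2) * K%:R).

(** Up to the oscillation over one sub-block, the potential drops at the rate
    given by the form at the mean velocity of the block paired with the mean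
    velocity of the last sub-block; the defect between these two velocities is
    charged to the energy gained by refining the block. *)
Lemma descent_one_scale K n t : (0 < K)%N -> (0 < n)%N -> (t + K * n <= L)%N ->
  B <= n%:R -> 4 * (2 * M ^+ 2 + 1) <= mu * c ^+ 2 * K%:R ->
  V (t + K * n) - V t <= - gam * (K * n)%:R +
   wgt K * (\sum_(b < K) energy (t + b * n) n - energy t (K * n)).
Proof.
move=> K0 n0 tL Bn Kbig; set m := (K * n)%N.
have nm : (n <= m)%N by rewrite /m leq_pmull.
have K0' : 0 < K%:R :> R by rewrite ltr0n.
have n0' : 0 < n%:R :> R by rewrite ltr0n.
pose x b := z (t + b * n + n)%N - z (t + b * n)%N.
have lK : (K.-1 < K)%N by rewrite prednK.
have sx : \sum_(b < K) x b = z (t + m)%N - z t.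
  rewrite -(big_mkord xpredT x) (eq_big_nat _ _
    (F2 := fun b => z (t + b.+1 * n)%N - z (t + b * n)%N)).
    by rewrite telescope_sumr // mul0n addn0.
  by move=> b _; rewrite /x mulSn [(n + _)%N]addnC addnA.
have := norm_dev_le_variance x lK; rewrite /= sx; set S := z _ - z t.
set D := x K.-1 - _ *: S => HD.
have xl : x K.-1 = z (t + m)%N - z (t + m - n)%N.
  have e : (t + K.-1 * n + n = t + m)%N.
    by rewrite -addnA [(_ * n + n)%N]addnC -mulSn prednK.
  by rewrite /x e -e addnK.
have tm : (t <= t + m <= L)%N by rewrite leq_addr.
have := potential_last_block nm tL; rewrite -xl -/S => Hlast.
have Hdot : dot (A S) (x K.-1) = K%:R^-1 * dot (A S) S + dot (A S) D.
  rewrite -[x K.-1](subrK (K%:R^-1 *: S)) -/D linearDr /= linearZr_LR /=.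
  by rewrite addrC.
have := cauchy_schwarz_abs (A S) D; rewrite ler_norml => /andP[HSD _].
have nA : norm (A S) <= M * m%:R.
  by have := norm_image_window tm; rewrite addKn.
have nS : c * m%:R <= norm S by have := cz tm; rewrite addKn.
have mE : m%:R = K%:R * n%:R :> R by rewrite natrM.
have HSS : mu * c ^+ 2 * (m%:R * n%:R) <= K%:R^-1 * dot (A S) S.
  rewrite [leRHS]mulrC ler_pdivlMr //; apply: le_trans (muA S).
  have : (c * m%:R) ^+ 2 <= norm S ^+ 2.
    by rewrite lerXn2r ?nnegrE ?norm_ge0 // mulr_ge0 // ltW.
  move=> /(ler_wpM2l (ltW mu0)); apply: le_trans.
  by rewrite mE; lra.
pose a := mu * c ^+ 2.
have a0 : 0 < a by rewrite mulr_gt0 // exprn_gt0.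
(* The product of the two errors is split so that a quarter of the gain pays for
   the part proportional to the length of the block. *)
have amgm : norm (A S) * norm D <=
    a / 4 * (m%:R * n%:R) + M ^+ 2 / a * K%:R * norm D ^+ 2.
  apply: (@le_trans _ _ (M * m%:R * norm D)); first by rewrite ler_wpM2r ?norm_ge0.
  rewrite -subr_ge0.
  have -> : a / 4 * (m%:R * n%:R) + M ^+ 2 / a * K%:R * norm D ^+ 2
      - M * m%:R * norm D = K%:R / a * (a / 2 * n%:R - M * norm D) ^+ 2.
    by rewrite mE; field; rewrite gt_eqF.
  by rewrite mulr_ge0 ?sqr_ge0 // ltW // divr_gt0.
have W0 : 0 <= M ^+ 2 / a * K%:R by rewrite mulr_ge0 ?divr_ge0 ?sqr_ge0 // ltW.
rewrite -(@ler_pM2l _ n%:R) // [leRHS]mulrDr.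
apply: le_trans Hlast _.
have -> : n%:R * (wgt K * (\sum_(b < K) energy (t + b * n) n - energy t m)) =
    M ^+ 2 / a * K%:R * (\sum_(b < K) norm (x b) ^+ 2 - norm S ^+ 2 / K%:R).
  have -> : \sum_(b < K) energy (t + b * n) n =
      (\sum_(b < K) norm (x b) ^+ 2) / n%:R.
    by rewrite mulr_suml.
  by rewrite -/S -/a mE; field; rewrite !gt_eqF.
have := ler_wpM2l W0 HD.
have : n%:R * (2 * M ^+ 2 * n%:R + B) <= a / 4 * (m%:R * n%:R).
  rewrite mE; apply: (@le_trans _ _ (n%:R * n%:R * (2 * M ^+ 2 + 1))).
    rewrite -[leRHS]mulrA ler_pM2l //; lra.
  have -> : a / 4 * (K%:R * n%:R * n%:R) = n%:R * n%:R * (a * K%:R / 4) by ring.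
  rewrite ler_pM2l ?mulr_gt0 //; rewrite /a; lra.
rewrite Hdot -/a; move: HSS amgm HSD; rewrite -/a.
have -> : n%:R * (- (a / 2) * m%:R) = - (a / 2) * (m%:R * n%:R) by ring.
set p := m%:R * n%:R; set q := M ^+ 2 / a * K%:R.
lra.
Qed.

(** Summing the one-scale estimates over all scales between [n0] and
    [n0 * K ^ s], the energy differences telescope. *)
Lemma descent_scales K n0 s t : (0 < K)%N -> (0 < n0)%N -> B <= n0%:R ->
  4 * (2 * M ^+ 2 + 1) <= mu * c ^+ 2 * K%:R -> (t + n0 * K ^ s <= L)%N ->
  s%:R * (V (t + n0 * K ^ s) - V t) <= - (s%:R * gam) * (n0 * K ^ s)%:R +
   wgt K * (M ^+ 2 * (n0 * K ^ s)%:R - energy t (n0 * K ^ s)).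
Proof.
move=> K0 n00 Bn0 Kbig; have M0 : 0 <= M by apply: le_trans M1.
have a0 : 0 < mu * c ^+ 2 by rewrite mulr_gt0 // exprn_gt0.
have W0 : 0 <= wgt K by rewrite mulr_ge0 ?divr_ge0 ?sqr_ge0 // ltW.
elim: s t => [|s IH] t.
  rewrite expn0 muln1; set n := n0 => tL.
  have n0' : 0 < n%:R :> R by rewrite ltr0n.
  rewrite !mul0r oppr0 mul0r add0r mulr_ge0 // subr_ge0 ler_pdivrMr //.
  have tn : (t <= t + n <= L)%N by rewrite leq_addr.
  have := norm_window tn; rewrite addKn => nz.
  have -> : M ^+ 2 * n%:R * n%:R = (M * n%:R) ^+ 2 by ring.
  by rewrite lerXn2r ?nnegrE ?norm_ge0 ?mulr_ge0.
set n := (n0 * K ^ s)%N.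
have mE : (n0 * K ^ s.+1 = K * n)%N by rewrite expnS mulnCA.
have n_gt0 : (0 < n)%N by rewrite muln_gt0 n00 expn_gt0 K0.
rewrite mE => tL.
have Bn : B <= n%:R.
  by apply: le_trans Bn0 _; rewrite ler_nat leq_pmulr // expn_gt0 K0.
have H1 := descent_one_scale K0 n_gt0 tL Bn Kbig.
have Hb (b : 'I_K) : s%:R * (V (t + b.+1 * n) - V (t + b * n)) <=
    - (s%:R * gam) * n%:R + wgt K * (M ^+ 2 * n%:R - energy (t + b * n) n).
  have -> : (t + b.+1 * n = t + b * n + n)%N.
    by rewrite mulSn [(n + _)%N]addnC addnA.
  apply: IH; apply: leq_trans tL; rewrite -addnA leq_add2l addnC -mulSn.
  by rewrite leq_mul2r ltn_ord orbT.
have := ler_sum (index_enum 'I_K) (P := xpredT) (fun b _ => Hb b).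
rewrite -mulr_sumr -(big_mkord xpredT (fun b => V (t + b.+1 * n) - V (t + b * n))).
rewrite telescope_sumr // mul0n addn0 big_split /= sumr_const card_ord.
rewrite -mulr_sumr sumrB sumr_const card_ord.
rewrite -[_ * n%:R *+ K]mulr_natl -[_ ^+ 2 * n%:R *+ K]mulr_natl.
move: H1; rewrite -[s.+1%:R]natr1 [(K * n)%:R]natrM.
move: (\sum_(b < K) _) => e.
move: (norm (z (t + K * n)%N - z t) ^+ 2 / _) => e'.
set dV := V _ - V t.
move=> H1 H2.
have -> : (s%:R + 1) * dV = dV + s%:R * dV by ring.
apply: le_trans (lerD H1 H2) _.
by lra.
Qed.

End Scales.
End Window.

Lemma increments_bounded (U : seq E) : exists2 M : R, 1 <= M &
  forall u, u \in U -> norm u <= M /\ norm (A u) <= M.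
Proof.
have [M M1 HM] := @seq_bounded_above R E U (fun u => norm u + norm (A u)).
exists M => // u /HM uM.
by split; apply: le_trans uM; rewrite ?lerDl ?lerDr norm_ge0.
Qed.

(** The number of scales is chosen so large that the total energy, which is
    bounded, pays for at most half of the gain on average over the scales. The
    smallest scale has to dominate [B], so that the window is proportional to
    [1 + B]. *)
Lemma potential_descent (U : seq E) (c : R) : 0 < c ->
  exists2 g : R, 0 < g & exists2 N0 : nat, (0 < N0)%N &
  forall (B : R) n0 z, (0 < n0)%N -> B <= n0%:R ->
    (forall k, (k < n0 * N0)%N -> greedy_step U B (z k) (z k.+1)) ->
    (forall i j, (i <= j <= n0 * N0)%N -> c * (j - i)%:R <= norm (z j - z i)) ->
  potential U (z (n0 * N0)%N) <= potential U (z 0%N) - g * (n0 * N0)%:R.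
Proof.
move=> c0; have [M M1 HM] := increments_bounded U.
have a0 : 0 < mu * c ^+ 2 by rewrite mulr_gt0 // exprn_gt0.
have up (x : R) : exists2 n : nat, (0 < n)%N & x <= n%:R.
  exists (Num.truncn x).+1 => //; have [x0|/ltW x0] := leP 0 x.
    by apply/ltW/truncnS_gt.
  exact: le_trans x0 _.
have [K K0 HK] := up (4 * (2 * M ^+ 2 + 1) / (mu * c ^+ 2)).
rewrite ler_pdivrMr // [leRHS]mulrC in HK.
pose Q := M ^+ 2 / (mu * c ^+ 2) * K%:R.
have [r r0 Hr] := up (2 * (Q * M ^+ 2) / (mu * c ^+ 2 / 2)).
rewrite ler_pdivrMr ?divr_gt0 // in Hr.
exists (mu * c ^+ 2 / 4); first by rewrite divr_gt0.
exists (K ^ r)%N; first by rewrite expn_gt0 K0.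
move=> B n0 z n00 Bn0 Hz cz.
have := descent_scales (t := 0) M1 (fun u uU => (HM u uU).1)
  (fun u uU => (HM u uU).2) Hz c0 cz K0 n00 Bn0 HK (leqnn _).
rewrite !add0n; set N := (n0 * K ^ r)%N; set dV := _ - _.
rewrite -/Q; have Q0 : 0 <= Q by rewrite mulr_ge0 ?divr_ge0 ?sqr_ge0 // ltW.
set e := _ ^+ 2 / N%:R; have e0 : 0 <= e by rewrite divr_ge0 ?sqr_ge0.
move=> H; rewrite -lerBlDl -/dV -(@ler_pM2l _ r%:R) ?ltr0n //.
apply: le_trans H _.
have Qe : 0 <= Q * e by rewrite mulr_ge0.
have := ler_wpM2r (ler0n R N) Hr.
lra.
Qed.

(** * Boundedness of the potential *)

(** Where the potential exceeds a multiple of the window length, all increments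
    of the window lie in one open half-space, so the trajectory moves at a
    definite speed there. *)
Lemma potential_bounded (U : seq E) : exists2 C : R, 0 <= C &
  forall (B : R) z, 0 <= B -> (forall k, greedy_step U B (z k) (z k.+1)) ->
    forall k, potential U (z k) <= potential U (z 0%N) + C * (1 + B).
Proof.
have [c c0 Hc] := halfspace_sum_bound U.
have [g g0 [N0 N00 Hg]] := potential_descent U c0.
have [M M1 HM] := increments_bounded U.
exists (1 + 4 * M ^+ 2 * N0%:R).
  by apply: addr_ge0 => //; apply: mulr_ge0 => //; apply: mulr_ge0; rewrite ?sqr_ge0.
move=> B z B0 Hz.
pose n0 := (Num.truncn B).+1; pose N := (n0 * N0)%N.
have Bn0 : B <= n0%:R by apply/ltW/truncnS_gt.
have n0B : n0%:R <= 1 + B by rewrite -natr1 addrC lerD2l truncn_le.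
have NB : N%:R <= (1 + B) * N0%:R by rewrite natrM ler_wpM2r.
have N_gt0 : (0 < N)%N by rewrite muln_gt0.
have HzL L k : (k < L)%N -> greedy_step U B (z k) (z k.+1) by [].
have MU u (uU : u \in U) : norm u <= M := (HM u uU).1.
have MAU u (uU : u \in U) : norm (A u) <= M := (HM u uU).2.
pose V k := potential U (z k).
have lip k j : V (k + j)%N <= V k + M ^+ 2 * j%:R.
  have := @potential_window U M B z (k + j) MU MAU (HzL _) k (k + j).
  by rewrite addKn; apply; rewrite leq_addr leqnn.
(* Over a window both the potential and the form at a fixed increment change by
   at most [M ^+ 2 * N%:R], so above [T] the sign of the latter persists. *)
pose T := B + 2 * M ^+ 2 * N%:R.
have window k : T < V k -> V (k + N)%N <= V k.
  move=> VT; suff : V (k + N)%N <= V k - g * N%:R.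
    by move=> H; apply: le_trans H _; rewrite gerBl mulr_ge0 // ltW.
  have := Hg B n0 (fun i => z (k + i)%N) isT Bn0; rewrite addn0 -/N; apply.
    by move=> i _; rewrite addnS; exact: Hz.
  move=> i j /andP[ij jN].
  have := Hc (- A (z k)) [seq z (k + l.+1)%N - z (k + l)%N | l <- index_iota i j].
  rewrite size_map size_iota big_map (telescope_sumr (fun l => z (k + l)%N)) //.
  apply=> u /mapP[l]; rewrite mem_index_iota => /andP[_ lj] ->; rewrite addnS.
  have [uU Hu] := Hz (k + l)%N; split => //; rewrite linearNl.
  have klL : (k <= k + l <= k + l)%N by rewrite leq_addr leqnn.
  have := potential_window_ge MU MAU (HzL _) klL.
  have := form_window MU MAU (HzL _) uU klL; rewrite addKn ler_norml.
  move=> /andP[Hl _]; rewrite [A (_ - z k)]linearB linearBl /= in Hl.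
  have : M ^+ 2 * l%:R <= M ^+ 2 * N%:R.
    by rewrite ler_wpM2l ?sqr_ge0 // ler_nat ltnW // (leq_trans lj).
  move: Hu VT; rewrite /T -/(V k) -/(V (k + l)%N) /=.
  lra.
have MN0 : 0 <= M ^+ 2 * N%:R by rewrite mulr_ge0 ?sqr_ge0.
have V0 : 0 <= V 0%N by exact: potential_ge0.
have multiples q : V (q * N)%N <= V 0%N + T + M ^+ 2 * N%:R.
  elim: q => [|q IH]; first by rewrite mul0n -addrA lerDl /T; lra.
  rewrite mulSn addnC; have [|Tq] := ltP T (V (q * N)%N).
    by move=> /window /le_trans; apply.
  by have := lip (q * N)%N N; lra.
move=> k; rewrite -/(V k) -/(V 0%N) {1}(divn_eq k N).
have : M ^+ 2 * (k %% N)%:R <= M ^+ 2 * N%:R.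
  by rewrite ler_wpM2l ?sqr_ge0 // ler_nat ltnW // ltn_mod.
have := lip (k %/ N * N)%N (k %% N)%N; have := multiples (k %/ N)%N.
have := ler_wpM2l (sqr_ge0 M) NB; rewrite /T; lra.
Qed.

(** * Trajectories with increments in an open half-space *)

(** The potential is nonnegative and decreases by a definite amount over each
    window, since moving in a half-space precludes slowing down. *)
Lemma halfspace_steps_bounded (U : seq E) (l : E) :
  (forall u, u \in U -> 0 < dot l u) ->
  exists2 C : R, 0 <= C & forall (B : R) z L, 0 <= B ->
    (forall k, (k < L)%N -> greedy_step U B (z k) (z k.+1)) ->
    L%:R <= C * (1 + B + potential U (z 0%N)).
Proof.
move=> lU; have [c c0 Hc] := halfspace_sum_bound U.
have [g g0 [N0 N00 Hg]] := potential_descent U c0.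
exists (N0%:R + g^-1); first by rewrite addr_ge0 // invr_ge0 ltW.
move=> B z L B0 Hz.
pose n0 := (Num.truncn B).+1; pose N := (n0 * N0)%N.
have Bn0 : B <= n0%:R by apply/ltW/truncnS_gt.
have n0B : n0%:R <= 1 + B by rewrite -natr1 addrC lerD2l truncn_le.
have NB : N%:R <= (1 + B) * N0%:R by rewrite natrM ler_wpM2r.
have N_gt0 : (0 < N)%N by rewrite muln_gt0.
pose V k := potential U (z k).
have windows q : (q * N <= L)%N -> V (q * N)%N <= V 0%N - g * (q * N)%:R.
  elim: q => [|q IH]; first by rewrite mul0n mulr0 subr0.
  rewrite mulSn [(N + _)%N]addnC => qL.
  have qL' : (q * N <= L)%N by apply: leq_trans qL; exact: leq_addr.
  suff : V (q * N + N)%N <= V (q * N)%N - g * N%:R.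
    by have := IH qL'; rewrite natrD; lra.
  have := Hg B n0 (fun i => z (q * N + i)%N) isT Bn0; rewrite addn0 -/N; apply.
    by move=> i iN; rewrite addnS; apply: Hz; apply: leq_trans qL; rewrite ltn_add2l.
  move=> i j /andP[ij jN].
  have := Hc l [seq z (q * N + k.+1)%N - z (q * N + k)%N | k <- index_iota i j].
  rewrite size_map size_iota big_map (telescope_sumr (fun k => z (q * N + k)%N)) //.
  apply=> u /mapP[k]; rewrite mem_index_iota => /andP[_ kj] ->; rewrite addnS.
  have [|uU _] := Hz (q * N + k)%N; last by split => //; exact: lU.
  by apply: leq_trans qL; rewrite ltn_add2l (leq_trans kj).
have := windows _ (leq_divM L N); have := potential_ge0 U (z (L %/ N * N)%N).
rewrite -/(V _) -/(V 0%N) => Vq Hq.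
have V0 : 0 <= V 0%N by exact: potential_ge0.
have LN : L%:R <= (L %/ N * N)%:R + N%:R :> R.
  by rewrite -natrD ler_nat {1}(divn_eq L N) leq_add2l ltnW // ltn_mod.
have Hq' : (L %/ N * N)%:R <= g^-1 * V 0%N.
  by rewrite mulrC ler_pdivlMr //; lra.
have : 0 <= g^-1 * (1 + B) by rewrite mulr_ge0 ?invr_ge0 ?ltW // ltr_pwDl.
have : 0 <= N0%:R * V 0%N by rewrite mulr_ge0.
lra.
Qed.

(** * The face of the origin and the projection along its span *)

Lemma form_bounded (U : seq E) : exists2 C : R, 1 <= C &
  forall v z, v \in U -> `|dot (A z) v| <= C * norm z.
Proof.
have H v : exists C : R, forall z, `|dot (A z) v| <= C * norm z.
  have [C _ HC] := scalar_bounded (dot v \o A : {scalar E}).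
  by exists C => z; rewrite dotC; exact: HC.
have [f Hf] := choice H.
have [C C1 HC] := @seq_bounded_above R E U f.
exists C => // v z /HC vC; apply: le_trans (Hf v z) _.
by rewrite ler_wpM2r ?norm_ge0.
Qed.

(** Coordinates are bounded functionals, so expanding the second argument of the
    form at [(y, y)] bounds the square of the norm by the norm. *)
Lemma norm_span_bounded (X : seq E) : exists2 C : R, 0 <= C &
  forall y b, y \in <<X>>%VS -> 0 <= b ->
    (forall v, v \in X -> dot (A y) v <= b /\ - b <= dot (A y) v) ->
    norm y <= C * b.
Proof.
have H (i : 'I_(size X)) : exists C : R,
    forall y, `|coord (in_tuple X) i y| <= C * norm y.
  have [C _ HC] := scalar_bounded (coord (in_tuple X) i : {scalar E}).
  by exists C => y; exact: HC.
have [f Hf] := choice H.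
have [C C1 HC] := @seq_bounded_above R _ (index_enum 'I_(size X)) f.
have C0 : 0 <= C by apply: le_trans C1.
exists ((size X)%:R * C / mu); first by rewrite divr_ge0 ?mulr_ge0 // ltW.
move=> y b yX b0 Hb.
have : mu * norm y ^+ 2 <= (size X)%:R * (C * norm y * b).
  apply: le_trans (muA y) _; rewrite {2}(@coord_span _ _ _ (in_tuple X) y yX).
  rewrite linear_sumr /= mulr_natl -[X in _ *+ X]card_ord -sumr_const.
  apply: ler_sum => i _; rewrite linearZr_LR /=.
  apply: le_trans (ler_norm _) _; rewrite normrM; apply: ler_pM => //.
    by apply: le_trans (Hf i y) _; rewrite ler_wpM2r ?norm_ge0 ?HC ?mem_index_enum.
  by rewrite ler_norml; have [-> ->] := Hb _ (mem_nth 0 (ltn_ord i)).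
have [y0|y0] := eqVneq (norm y) 0.
  by rewrite y0 !mulr_ge0 ?invr_ge0 // ltW.
have {}y0 : 0 < norm y by rewrite lt_def y0 norm_ge0.
rewrite expr2 mulrA => H'.
have : norm y * (mu * norm y) <= norm y * ((size X)%:R * C * b) by lra.
rewrite ler_pM2l // => H''.
by rewrite mulrAC ler_pdivlMr // mulrC.
Qed.

(** The linear systems defining [Y] are solvable by [lax_milgram_span], and
    positivity makes their solutions unique, hence additive. The projection is
    taken with respect to the form, so that [A (x - Y x)] is orthogonal to the
    span. *)
Lemma projection_along (X : seq E) : exists Y : E -> E,
  [/\ forall x, Y x \in <<X>>%VS,
      forall x v, v \in <<X>>%VS -> dot (A (Y x)) v = dot (A x) v,
      {morph Y : x y / x + y},
      {morph Y : x y / x - y}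
    & forall v, v \in <<X>>%VS -> Y v = v].
Proof.
have Apos x : x != 0 -> 0 < dot (A x) x.
  move=> x0; apply: lt_le_trans (muA x); rewrite mulr_gt0 // norm_sqr.
  exact: neq0_dnorm_gt0.
have ex x : exists y, y \in <<X>>%VS /\
    forall v, v \in X -> dot (A y) v = dot (A x) v.
  have [y yX Hy] := lax_milgram_span X Apos (dot (A x)).
  by exists y.
have [Y HY] := choice ex.
have YX x : Y x \in <<X>>%VS by case: (HY x).
have Yeq x v : v \in <<X>>%VS -> dot (A (Y x)) v = dot (A x) v.
  by apply: (@eq_scalar_span (dot (A (Y x))) (dot (A x))); case: (HY x).
have Y_uniq x y : y \in <<X>>%VS ->
    (forall v, v \in <<X>>%VS -> dot (A y) v = dot (A x) v) -> Y x = y.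
  move=> yX Hy; apply/eqP; rewrite -subr_eq0; apply/eqP.
  apply: contra_eq (_ : dot (A (Y x - y)) (Y x - y) = 0) => [/Apos/gt_eqF->//|].
  by rewrite [A _]linearB linearBl /= Yeq ?Hy ?memvB // subrr.
exists Y; split => //.
- move=> x y; apply: Y_uniq; first exact: memvD.
  by move=> v vX; rewrite !linearD !linearDl /= !Yeq.
- move=> x y; apply: Y_uniq; first exact: memvB.
  by move=> v vX; rewrite ![A (_ - _)]linearB !linearBl /= !Yeq.
- by move=> v vX; apply: Y_uniq.
Qed.

(** Positive relations can be added, so one of them has the largest support; the
    elements of [U] in this support are those of the minimal face, containing the
    origin, of the convex hull of [0 :: U]. *)
Lemma maximal_support (U : seq E) : exists w0 : E -> R,
  [/\ forall u, u \in U -> 0 <= w0 u, \sum_(u <- U) w0 u *: u = 0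
    & forall u (w : E -> R), u \in U -> (forall v, v \in U -> 0 <= w v) ->
      \sum_(v <- U) w v *: v = 0 -> 0 < w u -> 0 < w0 u].
Proof.
pose P (w : E -> R) := (forall v, v \in U -> 0 <= w v) /\
  \sum_(v <- U) w v *: v = 0.
suff H (s : seq E) : {subset s <= U} -> exists w0, P w0 /\
    forall u w, u \in s -> P w -> 0 < w u -> 0 < w0 u.
  have [w0 [[? ?] H0]] := H U (fun _ => id).
  by exists w0; split => // u w uU w_ge0 sw; exact: H0.
elim: s => [|x s IH] sU.
  exists (fun=> 0); split => //; split => // .
  by rewrite big1 // => v _; rewrite scale0r.
have [|w0 [[w00 sw0] H0]] := IH.
  by move=> v vs; apply: sU; rewrite inE vs orbT.
have xU : x \in U by apply: sU; rewrite inE eqxx.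
have [[w [[w_ge0 sw] wx]]|nex] := EM (exists w, P w /\ 0 < w x); last first.
  exists w0; split => // u w; rewrite inE => /orP[/eqP->|us Pw wu].
    by move=> Pw wx; case: nex; exists w.
  exact: H0 us Pw wu.
exists (fun u => w0 u + w u); split; first split.
- by move=> v vU; rewrite addr_ge0 ?w00 ?w_ge0.
- rewrite (eq_bigr (fun v => w0 v *: v + w v *: v)) ?big_split /= ?sw ?sw0 ?addr0 //.
  by move=> v _; rewrite scalerDl.
- move=> u w'; rewrite inE => /orP[/eqP-> _ _|us Pw' w'u].
    by rewrite ltr_wpDl ?w00.
  by rewrite ltr_pwDl ?(H0 u w') ?w_ge0 // sU // inE us orbT.
Qed.

(** Each vector of the face is, up to a positive factor, minus a nonnegative
    combination of the others, so the potential bounds the form on the face from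
    both sides. *)
Lemma face_form_bounded (U : seq E) (w0 : E -> R) :
  (forall u, u \in U -> 0 <= w0 u) -> \sum_(u <- U) w0 u *: u = 0 ->
  exists2 C : R, 1 <= C & forall z v, v \in U -> 0 < w0 v ->
    dot (A z) v <= C * potential U z.
Proof.
move=> w00 sw0; pose S := \sum_(u <- U) w0 u.
have [C C1 HC] := @seq_bounded_above R E U (fun v => S / w0 v).
exists C => // z v vU wv; set V := potential U z.
have V0 : 0 <= V by exact: potential_ge0.
have sV : \sum_(u <- U) w0 u * (dot (A z) u + V) = S * V.
  have -> : \sum_(u <- U) w0 u * (dot (A z) u + V) =
      \sum_(u <- U) dot (A z) (w0 u *: u) + S * V.
    rewrite /S mulr_suml -big_split; apply: eq_bigr => u _ /=.
    by rewrite linearZr_LR /= mulrDr.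
  by rewrite -linear_sumr sw0 linear0r add0r.
have Hv : w0 v * (dot (A z) v + V) <= S * V.
  rewrite -sV (big_rem v) //= lerDl big_seq; apply: sumr_ge0 => u /mem_rem uU.
  by rewrite mulr_ge0 ?w00 // -lerBlDr sub0r lerNl potential_ge.
have {}Hv : dot (A z) v + V <= S / w0 v * V.
  by rewrite mulrAC ler_pdivlMr // mulrC.
have := ler_wpM2r V0 (HC v vU); lra.
Qed.

(** A positive combination of projected vectors that vanishes would lift to a
    positive relation on [U] whose support exceeds the maximal one. *)
Lemma face_complement_separated (U : seq E) (w0 : E -> R) (Y : E -> E) :
  uniq U -> (forall u, u \in U -> 0 <= w0 u) -> \sum_(u <- U) w0 u *: u = 0 ->
  (forall u (w : E -> R), u \in U -> (forall v, v \in U -> 0 <= w v) ->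
      \sum_(v <- U) w v *: v = 0 -> 0 < w u -> 0 < w0 u) ->
  (forall x, Y x \in <<[seq u <- U | (0 < w0 u)%R]>>%VS) ->
  exists l, forall u, u \in U -> ~~ (0 < w0 u) -> 0 < dot l (u - Y u).
Proof.
move=> uU w00 sw0 max YX.
set U0 := [seq u <- U | 0 < w0 u] in YX; pose U1 := [seq u <- U | ~~ (0 < w0 u)].
have [[l Hl]|[w [w_ge0 [j jU1 wj] sw]]] :=
    @gordan E U1 (fun u => u - Y u) (filter_uniq _ uU).
  by exists l => u uU' wu; apply: Hl; rewrite mem_filter wu.
have [jw jU] : ~~ (0 < w0 j) /\ j \in U by move: jU1; rewrite mem_filter => /andP.
have [c Hc] : exists c : E -> R, \sum_(i <- U1) w i *: i = \sum_(v <- U0) c v *: v.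
  apply: span_weights; first exact: filter_uniq.
  have -> : \sum_(i <- U1) w i *: i = \sum_(i <- U1) w i *: Y i.
    apply/eqP; rewrite -subr_eq0 -sumrB -[X in _ == X]sw; apply/eqP.
    by apply: eq_bigr => i _; rewrite scalerBr.
  by apply: rpred_sum => i _; exact: memvZ.
have [t _ Ht] := @seq_bounded_above R E U0 (fun v => c v / w0 v).
pose W u := if 0 < w0 u then t * w0 u - c u else w u.
case/negP: (jw); apply: (max j W) => //.
- move=> u uU'; rewrite /W; case: ifPn => wu.
    by rewrite subr_ge0 -ler_pdivrMr // Ht // mem_filter wu.
  by apply: w_ge0; rewrite mem_filter wu.
- rewrite (bigID (fun u => 0 < w0 u)) /= -[X in X + _ = _]big_filter.
  rewrite -[X in _ + X = _]big_filter.
  rewrite (eq_big_seq (fun v => t *: (w0 v *: v) - c v *: v)) => [|v]; last first.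
    by rewrite mem_filter /W => /andP[wv _]; rewrite wv scalerBl scalerA.
  rewrite [X in _ + X](eq_big_seq (fun v => w v *: v)) => [|v]; last first.
    by rewrite mem_filter /W => /andP[/negPf wv _]; rewrite wv.
  rewrite sumrB -scaler_sumr -/U0 -/U1 Hc subrK.
  suff -> : \sum_(v <- U0) w0 v *: v = 0 by rewrite scaler0.
  rewrite -[RHS]sw0 [RHS](bigID (fun u => 0 < w0 u)) /= -[X in _ = X + _]big_filter.
  rewrite -[X in _ = _ + X]big_filter.
  rewrite [X in _ = _ + X]big1_seq ?addr0 // => v; rewrite mem_filter.
  move=> /andP[_ /andP[wv vU]]; have := w00 _ vU.
  by rewrite le_eqVlt (negPf wv) orbF => /eqP<-; rewrite scale0r.
- by rewrite /W (negPf jw).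
Qed.

(** * Boundedness of greedy trajectories *)

Lemma greedy_bounded (U : seq E) : uniq U -> exists2 C : R, 1 <= C &
  forall (B : R) z, 0 <= B -> (forall k, greedy_step U B (z k) (z k.+1)) ->
    forall k, norm (z k) <= C * (1 + norm (z 0%N) + B).
Proof.
move=> uU.
have [w0 [w00 sw0 max]] := maximal_support U.
pose U0 := [seq u <- U | 0 < w0 u]; pose U1 := [seq u <- U | ~~ (0 < w0 u)].
have [Y [YX Yeq YD YB Yid]] := projection_along U0.
have [l Hl] := face_complement_separated uU w00 sw0 max YX.
pose U' := [seq u - Y u | u <- U1].
have lU' u : u \in U' -> 0 < dot l u.
  by move=> /mapP[v]; rewrite mem_filter => /andP[wv vU] ->; exact: Hl.
have [Cf Cf1 HCf] := form_bounded U.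
have [Cw Cw1 HCw] := face_form_bounded w00 sw0.
have [Cs Cs0 HCs] := norm_span_bounded U0.
have [C1 C10 HC1] := potential_bounded U.
have [C2 C20 HC2] := halfspace_steps_bounded lU'.
have [M M1 HM] := increments_bounded U'.
have Cf0 : 0 <= Cf by apply: le_trans Cf1.
have Cw0 : 0 <= Cw by apply: le_trans Cw1.
have M0 : 0 <= M by apply: le_trans M1.
pose CY := Cs * Cw; have CY0 : 0 <= CY by rewrite mulr_ge0.
have normY z : norm (Y z) <= CY * potential U z.
  rewrite /CY -mulrA; apply: HCs => //; first by rewrite mulr_ge0 ?potential_ge0.
  move=> v vU0; have := vU0; rewrite mem_filter => /andP[wv vU].
  rewrite Yeq ?memv_span //; split; first exact: HCw.
  rewrite lerNl; apply: le_trans (potential_ge z vU) _.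
  by rewrite ler_peMl ?potential_ge0.
pose h z := z - Y z.
have hE z v : v \in U -> dot (A (h z)) (v - Y v) = dot (A z) v - dot (A (Y z)) v.
  move=> vU; rewrite [A (h z)]linearB linearBl /= !linearBr /= (Yeq z (Y v)) //.
  lra.
have formY z v : v \in U -> `|dot (A (Y z)) v| <= Cf * CY * potential U z.
  move=> vU; apply: le_trans (HCf _ _ vU) _.
  by rewrite -mulrA ler_wpM2l ?normY.
pose k1 := Cf + C1; pose k2 := 1 + 2 * (Cf * CY * k1).
pose k3 := k1 + Cf * CY * k1.
have k10 : 0 <= k1 by rewrite addr_ge0.
have CCk0 : 0 <= Cf * CY * k1 by rewrite !mulr_ge0.
have k20 : 0 <= k2 by rewrite /k2; lra.
have k30 : 0 <= k3 by rewrite /k3; lra.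
exists (1 + 2 * (CY * k1) + M * (C2 * (1 + k2 + k3))).
  have : 0 <= M * (C2 * (1 + k2 + k3)) by apply: mulr_ge0 => //; apply: mulr_ge0 => //; lra.
  have : 0 <= CY * k1 by rewrite mulr_ge0.
  lra.
move=> B z B0 Hz k; set X := 1 + norm (z 0%N) + B.
have n0 := norm_ge0 (z 0%N).
have X1 : 1 <= X by rewrite /X; lra.
have X0 : 0 <= X by apply: le_trans X1.
have VW j : potential U (z j) <= k1 * X.
  apply: le_trans (HC1 B z B0 Hz j) _.
  have : potential U (z 0%N) <= Cf * norm (z 0%N).
    apply: potential_le; first by rewrite mulr_ge0.
    by move=> v vU; have := HCf _ (z 0%N) vU; rewrite ler_norml; lra.
  have : 0 <= Cf * (1 + B) by rewrite mulr_ge0 // addr_ge0.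
  have : 0 <= C1 * norm (z 0%N) by rewrite mulr_ge0.
  by rewrite /k1 /X; lra.
have YW j : norm (Y (z j)) <= CY * k1 * X.
  by apply: le_trans (normY _) _; rewrite -[leRHS]mulrA ler_wpM2l.
have formYW j v : v \in U -> `|dot (A (Y (z j))) v| <= Cf * CY * k1 * X.
  move=> vU; apply: le_trans (formY _ _ vU) _.
  by rewrite -[leRHS]mulrA ler_wpM2l // mulr_ge0.
have pot' j : potential U' (h (z j)) <= potential U (z j) + Cf * CY * k1 * X.
  apply: potential_le; first by rewrite addr_ge0 ?potential_ge0 ?mulr_ge0.
  move=> x /mapP[v]; rewrite mem_filter => /andP[_ vU] ->; rewrite hE //.
  have := potential_ge (z j) vU; have := formYW j _ vU; rewrite ler_norml; lra.
(* The projected trajectory stands still while the increments stay in the face;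
   deleting these steps leaves a greedy trajectory for [U']. *)
have [L [g [g0 gL Hg]]] : exists L g, [/\ g 0%N = h (z 0%N), g L = h (z k)
    & forall j, (j < L)%N -> greedy_step U' (k2 * X) (g j) (g j.+1)].
  elim: k => [|k [L [g [g0 gL Hg]]]]; first by exists 0%N, (fun=> h (z 0%N)).
  have [uU' Hu] := Hz k; set u := z k.+1 - z k in uU' Hu.
  have hu : h (z k.+1) - h (z k) = u - Y u.
    rewrite /h /u YB !opprB addrACA [RHS]addrACA.
    by congr (_ + _); exact: addrC.
  case: (boolP (0 < w0 u)) => wu.
    exists L, g; split => //; rewrite gL; apply/esym/eqP; rewrite -subr_eq0 hu.
    by rewrite Yid ?subrr // memv_span // mem_filter wu.
  exists L.+1, (fun j => if (j <= L)%N then g j else h (z k.+1)); split => //.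
    by rewrite ltnn.
  move=> j jL1; have [->|jL] := eqVneq j L; last first.
    have {}jL : (j < L)%N by rewrite ltn_neqAle jL -ltnS.
    by rewrite jL (ltnW jL); exact: Hg.
  rewrite leqnn ltnn gL; split; rewrite hu.
    by apply/mapP; exists u => //; rewrite mem_filter wu.
  rewrite hE //; have := pot' k; have := formYW k _ uU'; rewrite ler_norml.
  have : B <= X by rewrite /X; lra.
  by rewrite /k2; lra.
have B'0 : 0 <= k2 * X by rewrite mulr_ge0.
have LX : L%:R <= C2 * (1 + k2 + k3) * X.
  apply: le_trans (HC2 _ _ _ B'0 Hg) _; rewrite -mulrA ler_wpM2l // g0.
  by have := pot' 0%N; have := VW 0%N; rewrite /k3; lra.
have hL : norm (h (z k) - h (z 0%N)) <= M * L%:R.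
  have := norm_window (fun u uU => (HM u uU).1) Hg (i := 0) (j := L).
  by rewrite g0 gL subn0; apply; rewrite leqnn.
have ML := ler_wpM2l M0 LX.
have -> : z k = Y (z k) + (z 0%N - Y (z 0%N) + (h (z k) - h (z 0%N))).
  by rewrite -/(h (z 0%N)) [h (z 0%N) + _]addrC subrK /h addrC subrK.
have t1 := norm_triangle (Y (z k)) (z 0%N - Y (z 0%N) + (h (z k) - h (z 0%N))).
have t2 := norm_triangle (z 0%N - Y (z 0%N)) (h (z k) - h (z 0%N)).
have t3 := norm_triangle (z 0%N) (- Y (z 0%N)).
rewrite normN in t3; have Y0 := YW 0%N; have Yk := YW k.
have : norm (z 0%N) <= X by rewrite /X; lra.
by move: t1 t2 t3; lra.
Qed.
End Greedy.
End Euclidean.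

Theorem theorem1 (R : realType) (E : vectType R) (dot : {dot E for idfun})
    (U : {fset E}) (hU : U != fset0) (hconv : conv U 0)
    (A : {linear E -> E})
    (hA : exists mu : R,
        0 < mu /\ forall x : E, mu * dnorm dot x ^+ 2 <= dot (A x) x) :
  exists C : R, 1 <= C /\
    forall (B : R) (z u : nat -> E),
      0 <= B -> trajectory U z u -> approximate dot U A B z u ->
      (ereal_sup [set (dnorm dot (z k))%:E | k in [set: nat]]
        <= (C * (1 + dnorm dot (z 0%N) + B))%:E)%E.
Proof.
have [mu [mu0 muA]] := hA.
have [C C1 HC] := greedy_bounded mu0 muA (fset_uniq U).
exists C; split=> // B z u B0 traj appr.
apply: ge_ereal_sup => _ [k _ <-]; rewrite lee_fin; apply: HC => // {}k.
have [uU zS] := traj k; rewrite /greedy_step zS addrAC subrr add0r; split=> //.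
have min_le v : v \in U -> fset_min U (fun v => dot (A (z k)) v) <= dot (A (z k)) v.
  move=> vU; rewrite /fset_min; move: (dot _ (head _ _)) => d.
  move: vU; rewrite -[v \in U]/(v \in enum_fset U); elim: (enum_fset U) => // w s IH.
  rewrite inE big_cons ge_min => /orP[/eqP->|/IH->]; first by rewrite lexx.
  by rewrite orbT.
have le_B v : v \in U -> dot (A (z k)) (u k) <= dot (A (z k)) v + B.
  by move=> /min_le vU; apply: le_trans (appr k) _; rewrite lerD2r.
suff : potential dot A U (z k) <= B - dot (A (z k)) (u k) by lra.
apply: potential_le; last by move=> v /le_B; lra.
rewrite subr_ge0; have [w [w_ge0 w1 sw]] := hconv.
have <- : \sum_(v <- U) w v * (dot (A (z k)) v + B) = B.
  have -> : \sum_(v <- U) w v * (dot (A (z k)) v + B) =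
      \sum_(v <- U) dot (A (z k)) (w v *: v) + (\sum_(v <- U) w v) * B.
    rewrite mulr_suml -big_split; apply: eq_bigr => v _ /=.
    by rewrite linearZr_LR /= mulrDr.
  by rewrite -linear_sumr sw linear0r add0r w1 mul1r.
rewrite -[leLHS]mul1r -w1 mulr_suml big_seq [leRHS]big_seq.
by apply: ler_sum => v vU; rewrite ler_wpM2l ?w_ge0 ?le_B.
Qed.
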